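(* Let $q\in\mathbb{C}$ with $0<|q|<1$, let $h\in\mathbb{Z}^{+}$, let $\xi\in\mathbb{C}$ be a root of unity, and let $a,f$ be integers with $0<a<f$. Let $n\in\mathbb{Z}^{+}$. Then $$H_{\xi,q}^{(h)}(1-n,a:f)=-\frac{q^{ha}\xi^{a}f^{n-1}B_{n,\xi^{f}}^{(h)}\left(\frac{a}{f},q^{f}\right)}{n}.$$
   Context: Fix a value of $\log q$, and put $\log q^{h}=h\log q$, $\log q^{f}=f\log q$, $\log (q^f)^h=hf\log q$. The twisted $(h,q)$-partial zeta function is defined, for complex $s\neq 1$ and integers $0<a<f$, by $$H_{\xi,q}^{(h)}(s,a:f)=\sum_{\substack{n\equiv a\,(\mathrm{mod}\, f)\\ n>0}}\frac{q^{nh}\xi^{n}}{n^{s}}-\frac{\log q^{h}}{s-1}\sum_{\substack{n\equiv a\,(\mathrm{mod}\, f)\\ n>0}}\frac{q^{nh}\xi^{n}}{n^{s-1}}.$$ The twisted $(h,q)$-Bernoulli polynomials $B_{n,\xi}^{(h)}(z,q)$ are defined by $$\frac{(t+\log q^{h})e^{tz}}{\xi q^{h}e^{t}-1}=\sum_{n=0}^{\infty}B_{n,\xi}^{(h)}(z,q)\frac{t^{n}}{n!},$$ and $B_{n,\xi^f}^{(h)}(z,q^f)$ is obtained by replacing $(\xi,q)$ by $(\xi^f,q^f)$. *)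

(* Defs.v *)
(* Stdlib reals, with Coquelicot's complex numbers and series. *)
From Stdlib Require Import Reals Factorial ClassicalEpsilon.
From Coquelicot Require Import Coquelicot.

Open Scope C_scope.

Definition Cexp (z : C) : C :=
  (exp (Re z) * cos (Im z), exp (Re z) * sin (Im z))%R.

(* [k ^ s] with the real logarithm of [k]; meant for [0 < k]. *)
Definition nat_cpow (k : nat) (s : C) : C := Cexp (s * RtoC (ln (INR k))).

(* Coquelicot's total operator [Series] is real-valued; a series of complex
   numbers converges iff its real and imaginary parts do. *)
Definition CSeries (u : nat -> C) : C :=
  (Series (fun k => Re (u k)), Series (fun k => Im (u k))).

Definition sum_congr (a f : nat) (u : nat -> C) : C :=
  CSeries (fun k =>
    if (Nat.ltb 0 k && Nat.eqb (k mod f) (a mod f))%bool then u k else 0).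

Definition root_of_unity (xi : C) : Prop :=
  exists m : nat, (0 < m)%nat /\ xi ^ m = 1.

(* The argument [logq] is the chosen value of [log q], so that
   [log q ^ h] is [INR h * logq]. *)
Definition hq_partial_zeta (logq q xi : C) (h : nat) (s : C) (a f : nat) : C :=
  sum_congr a f (fun k => q ^ (k * h) * xi ^ k / nat_cpow k s)
  - RtoC (INR h) * logq / (s - 1)
    * sum_congr a f (fun k => q ^ (k * h) * xi ^ k / nat_cpow k (s - 1)).

(* The generating function is analytic at [t = 0] when [xi * q ^ h <> 1]; the
   identity between it and its exponential series is required near [0]. *)
Definition is_hq_bernoulli (logq q xi : C) (h : nat) (z : C) (B : nat -> C) :
  Prop :=
  exists r : R, (0 < r)%R /\
    forall t : C, (Cmod t < r)%R ->
      @is_series C_AbsRing C_NormedModule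
        (fun n => B n * (t ^ n / RtoC (INR (fact n))))
        ((t + RtoC (INR h) * logq) * Cexp (t * z)
         / (xi * q ^ h * Cexp t - 1)).

(* The coefficients are determined by the expansion, so [epsilon] selects the
   only sequence satisfying it whenever there is one. *)
Definition hq_bernoulli (logq q xi : C) (h n : nat) (z : C) : C :=
  epsilon (inhabits (fun _ : nat => RtoC 0))
    (is_hq_bernoulli logq q xi h z) n.

(* Main.v *)
Require Import Defs.
From Stdlib Require Import Reals Factorial Lra Lia ClassicalEpsilon.
From Coquelicot Require Import Coquelicot.

(* Put [W = xi^f q^(hf)], so [|W| < 1].  Near [t = 0] a geometric series gives
   [exp (t z) / (1 - W exp t) = sum_j W^j exp (t (z + j))], and expanding each
   exponential (dominated convergence in [j]) exhibits the moments
   [M_n = sum_j W^j (z + j)^n] as its Taylor coefficients.  Multiplying by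
   [-(t + L)] with [L = h f log q], uniqueness of coefficients yields
   [B_n = - (L M_n + n M_(n-1))].  At [z = a / f] the two sums of the partial zeta
   function at [s = 1 - n], split along [k = a + j f], are multiples of [M_(n-1)]
   and [M_n]. *)

Open Scope C_scope.

(** * Dominated convergence for series in a normed module *)

(** Between [J] and a later index [n], the partial sums of [a] move by at most the increment of
    those of [M]. As [M] dominates norms it is nonnegative, so its partial sums stay below [m];
    letting [n] grow gives the tail bound. *)
Lemma is_series_bound_tail {K : AbsRing} {V : NormedModule K}
  (a : nat -> V) (l : V) (M : nat -> R) (m : R) (J : nat) :
  (forall j, (norm (a j) <= M j)%R) ->
  is_series a l -> is_series M m ->
  (norm (minus (sum_n a J) l) <= m - sum_n M J)%R.
Proof.
  intros HaM Ha HM.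
  assert (HMm : forall n, (sum_n M n <= m)%R).
  { apply (is_lim_seq_incr_compare (sum_n M) m HM).
    intros n. rewrite sum_Sn. unfold plus; simpl.
    generalize (HaM (S n)) (norm_ge_0 (a (S n))). lra. }
  apply le_epsilon. intros eps Heps.
  destruct (proj1 (filterlim_locally_ball_norm (sum_n a) l) Ha (mkposreal eps Heps))
    as [N HN].
  set (n := Nat.max N J).
  specialize (HN n ltac:(unfold n; lia)). unfold ball_norm in HN; simpl in HN.
  assert (HJ : (norm (minus (sum_n a n) (sum_n a J)) <= sum_n M n - sum_n M J)%R).
  {
    pose proof (sum_n_m_sum_n a J n ltac:(unfold n; lia)) as Ea.
    pose proof (sum_n_m_sum_n M J n ltac:(unfold n; lia)) as EM.
    change (sum_n M n - sum_n M J)%R with (minus (sum_n M n) (sum_n M J)).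
    replace (minus (sum_n a n) (sum_n a J)) with (sum_n_m a (S J) n) by exact Ea.
    replace (minus (sum_n M n) (sum_n M J)) with (sum_n_m M (S J) n) by exact EM.
    eapply Rle_trans; [apply norm_sum_n_m|].
    now apply sum_n_m_le. }
  replace (minus (sum_n a J) l)
    with (plus (minus (sum_n a J) (sum_n a n)) (minus (sum_n a n) l))
    by (symmetry; apply minus_trans).
  eapply Rle_trans; [apply norm_triangle|].
  replace (minus (sum_n a J) (sum_n a n)) with (opp (minus (sum_n a n) (sum_n a J)))
    by apply opp_minus.
  rewrite norm_opp. generalize (HMm n). lra.
Qed.

Lemma filterlim_sum_n {K : AbsRing} {V : NormedModule K}
  (a : nat -> nat -> V) (b : nat -> V) (J : nat) :
  (forall j, filterlim (fun n => a n j) eventually (locally (b j))) ->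
  filterlim (fun n => sum_n (a n) J) eventually (locally (sum_n b J)).
Proof.
  intros H. induction J as [|J IH].
  - rewrite sum_O. eapply filterlim_ext; [|apply H].
    intros n; simpl. now rewrite sum_O.
  - rewrite sum_Sn.
    eapply filterlim_ext; [intros n; symmetry; apply sum_Sn|].
    eapply filterlim_comp_2; [exact IH|apply H|apply filterlim_plus].
Qed.

(* Dominated convergence makes the partial sums converge uniformly in [n], which
   permits the exchange of limits. *)
Lemma series_dominated_convergence {K : AbsRing} {V : NormedModule K}
  (a : nat -> nat -> V) (b s : nat -> V) (l : V) (M : nat -> R) :
  ex_series M -> (forall n j, (norm (a n j) <= M j)%R) ->
  (forall j, filterlim (fun n => a n j) eventually (locally (b j))) ->
  (forall n, is_series (a n) (s n)) -> is_series b l ->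
  filterlim s eventually (locally l).
Proof.
  intros [m HM] Hdom Hlim Hs Hb.
  apply (filterlim_switch_1 eventually _ eventually _
    (fun J n => sum_n (a n) J) s (fun J => sum_n b J) l).
  - apply filterlim_locally. intros eps.
    destruct (proj1 (filterlim_locally_ball_norm (sum_n M) m) HM eps) as [N HN].
    exists N. intros J HJ n. specialize (HN J HJ).
    apply norm_compat1.
    eapply Rle_lt_trans; [exact (is_series_bound_tail _ _ _ _ J (Hdom n) (Hs n) HM)|].
    unfold ball_norm, norm, minus, plus, opp in HN; simpl in HN.
    unfold abs in HN; simpl in HN. apply Rabs_def2 in HN. lra.
  - intros J. now apply filterlim_sum_n.
  - exact Hb.
Qed.

(** * The complex exponential and its Taylor bounds *)

Local Notation is_Cseries := (@is_series C_AbsRing C_NormedModule).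

(** Testing with the conjugate of [d] gives [Cmod d ^ 2 <= Cmod d * B], and a nonzero [Cmod d]
    cancels. *)
Lemma Cmod_le_of_Re_mult (d : C) (B : R) :
  (forall c, (Re (c * d) <= Cmod c * B)%R) -> (Cmod d <= B)%R.
Proof.
  intros H.
  destruct (Req_dec (Cmod d) 0) as [E|E].
  - rewrite E. apply Cmod_eq_0 in E. subst d.
    generalize (H 1). rewrite Cmult_0_r, Cmod_1. simpl. lra.
  - assert (0 < Cmod d)%R by (generalize (Cmod_ge_0 d); lra).
    specialize (H (Cconj d)). rewrite Cmod_conj in H.
    replace (Re (Cconj d * d)) with (Cmod d * Cmod d)%R in H; [nra|].
    rewrite Cmult_comm, <- Cmod2_conj. rewrite re_RtoC. ring.
Qed.

Lemma Cexp_plus (x y : C) : Cexp (x + y) = Cexp x * Cexp y.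
Proof.
  unfold Cexp, Cmult, Cplus, Re, Im; simpl.
  rewrite exp_plus, cos_plus, sin_plus. f_equal; ring.
Qed.

Lemma Cexp_0 : Cexp 0 = 1.
Proof.
  unfold Cexp, Re, Im, RtoC; simpl.
  rewrite exp_0, cos_0, sin_0. f_equal; ring.
Qed.

Lemma Cexp_INR_mult (n : nat) (z : C) : Cexp (RtoC (INR n) * z) = Cexp z ^ n.
Proof.
  induction n as [|n IH].
  - simpl INR. rewrite Cmult_0_l. exact Cexp_0.
  - rewrite S_INR, RtoC_plus, Cpow_S, <- IH, <- Cexp_plus. f_equal. ring.
Qed.

Lemma Cmod_Cexp (z : C) : Cmod (Cexp z) = exp (Re z).
Proof.
  unfold Cexp, Cmod; simpl fst; simpl snd.
  replace (_ + _)%R with (Rsqr (exp (Re z)) * (Rsqr (sin (Im z)) + Rsqr (cos (Im z))))%R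
    by (unfold Rsqr; ring).
  rewrite sin2_cos2, Rmult_1_r. apply sqrt_Rsqr. left; apply exp_pos.
Qed.

Lemma exp_nondecreasing (x y : R) : (x <= y -> exp x <= exp y)%R.
Proof.
  intros [H|H]; [left; now apply exp_increasing|subst; apply Rle_refl].
Qed.

Lemma Cmod_Cexp_le (z : C) : (Cmod (Cexp z) <= exp (Cmod z))%R.
Proof.
  rewrite Cmod_Cexp. apply exp_nondecreasing.
  generalize (re_le_Cmod z) (Rle_abs (Re z)). lra.
Qed.

Lemma is_derive_Re_Cexp (c z : C) (s : R) :
  is_derive (fun s => Re (c * Cexp (RtoC s * z))) s (Re (c * z * Cexp (RtoC s * z))).
Proof.
  destruct c as [c1 c2], z as [x y].
  unfold Cexp, Cmult, Re, Im, RtoC; simpl.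
  auto_derive; [easy|]. unfold Rminus. ring.
Qed.

Lemma is_derive_n_Re_Cexp (z : C) (n : nat) : forall (c : C) (s : R),
  is_derive_n (fun s => Re (c * Cexp (RtoC s * z))) n s
    (Re (c * z ^ n * Cexp (RtoC s * z))).
Proof.
  induction n as [|n IH]; intros c s.
  - unfold is_derive_n. replace (c * z ^ 0) with c by (simpl; ring). reflexivity.
  - unfold is_derive_n. apply is_derive_ext with (fun s => Re (c * z ^ n * Cexp (RtoC s * z))).
    + intros t. symmetry. apply is_derive_n_unique, IH.
    + replace (c * z ^ S n) with (c * z ^ n * z) by (rewrite Cpow_S; ring).
      apply is_derive_Re_Cexp.
Qed.

Lemma Re_sum_n (u : nat -> C) (n : nat) : Re (sum_n u n) = sum_n (fun k => Re (u k)) n.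
Proof.
  induction n as [|n IH]; [now rewrite !sum_O|].
  rewrite !sum_Sn. change (plus (sum_n u n) (u (S n))) with (sum_n u n + u (S n)).
  now rewrite re_plus, IH.
Qed.

Lemma Im_sum_n (u : nat -> C) (n : nat) : Im (sum_n u n) = sum_n (fun k => Im (u k)) n.
Proof.
  induction n as [|n IH]; [now rewrite !sum_O|].
  rewrite !sum_Sn. change (plus (sum_n u n) (u (S n))) with (sum_n u n + u (S n)).
  now rewrite im_plus, IH.
Qed.

Definition exp_taylor (z : C) (n : nat) : C :=
  sum_n (fun k => z ^ k / RtoC (INR (fact k))) n.

Lemma Cdiv_INR_fact (z : C) (k : nat) :
  z / RtoC (INR (fact k)) = z * RtoC (/ INR (fact k)).
Proof. unfold Cdiv. now rewrite RtoC_inv by apply INR_fact_neq_0. Qed.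

Lemma Cmod_div_fact (z : C) (k : nat) :
  Cmod (z / RtoC (INR (fact k))) = (Cmod z / INR (fact k))%R.
Proof.
  rewrite Cdiv_INR_fact, Cmod_mult, Cmod_R, Rabs_pos_eq; [reflexivity|].
  left. apply Rinv_0_lt_compat, INR_fact_lt_0.
Qed.

(* Taylor-Lagrange is applied to the real functions [s |-> Re (c exp (s z))]: it
   fails for complex-valued functions, and varying [c] recovers the modulus. *)
Lemma exp_taylor_error (z : C) (n : nat) :
  (Cmod (Cexp z - exp_taylor z n)
   <= exp (Cmod z) * (Cmod z ^ S n / INR (fact (S n))))%R.
Proof.
  apply Cmod_le_of_Re_mult. intros c.
  destruct (Taylor_Lagrange (fun s => Re (c * Cexp (RtoC s * z))) n 0 1)
    as [zeta [Hzeta E]]; [lra| |].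
  { intros t _ k _.
    destruct k; [exact I|].
    eexists. apply (is_derive_n_Re_Cexp z (S k) c t). }
  rewrite (is_derive_n_unique _ _ _ _ (is_derive_n_Re_Cexp z (S n) c zeta)) in E.
  replace (c * (Cexp z - exp_taylor z n)) with (c * Cexp z + - (c * exp_taylor z n)) by ring.
  rewrite Cmult_1_l in E.
  rewrite re_plus, re_opp, E.
  rewrite <- sum_n_Reals.
  (* The Taylor polynomial at [0] of the real function, evaluated at [1], is
     [Re (c * exp_taylor z n)]. It cancels, and only the Lagrange remainder is left. *)
  replace (Re (c * exp_taylor z n)) with
   (sum_n (fun m : nat =>
      ((1 - 0) ^ m / INR (fact m) *
       Derive_n (fun s : R => Re (c * Cexp (RtoC s * z))) m 0)%R) n).
  2:{ unfold exp_taylor.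
      replace (c * sum_n (fun k => z ^ k / RtoC (INR (fact k))) n) with
        (sum_n (fun k => c * (z ^ k / RtoC (INR (fact k)))) n) by apply (sum_n_mult_l (K := C_Ring)).
      rewrite Re_sum_n. apply sum_n_ext. intros m.
      rewrite (is_derive_n_unique _ _ _ _ (is_derive_n_Re_Cexp z m c 0)).
      rewrite Cmult_0_l, Cexp_0, Cmult_1_r, Rminus_0_r, pow1, Cdiv_INR_fact, Cmult_assoc, re_scal_r.
      unfold Rdiv. now rewrite Rmult_1_l, Rmult_comm. }
  rewrite Rminus_0_r, pow1.
  match goal with |- (?a + ?b + - ?a <= _)%R => replace (a + b + - a)%R with b by ring end.
  apply Rle_trans with (1 / INR (fact (S n)) * (Cmod c * Cmod z ^ S n * exp (Cmod z)))%R.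
  2:{ apply Req_le. unfold Rdiv. ring. }
  apply Rmult_le_compat_l.
  { unfold Rdiv. rewrite Rmult_1_l. left. apply Rinv_0_lt_compat, INR_fact_lt_0. }
  eapply Rle_trans; [apply Rle_abs|]. eapply Rle_trans; [apply re_le_Cmod|].
  rewrite !Cmod_mult, Cmod_pow.
  apply Rmult_le_compat_l.
  { apply Rmult_le_pos; [apply Cmod_ge_0|apply pow_le, Cmod_ge_0]. }
  eapply Rle_trans; [apply Cmod_Cexp_le|]. apply exp_nondecreasing.
  (* The intermediate point [zeta] lies between [0] and [1], so multiplying by it does not increase
     the modulus. *)
  rewrite Cmod_mult, Cmod_R, Rabs_pos_eq by lra.
  generalize (Cmod_ge_0 z). nra.
Qed.

(** * Convergence of complex series *)

Lemma filterlim_C_Cmod (s : nat -> C) (l : C) (e : nat -> R) :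
  (forall n, (Cmod (s n - l) <= e n)%R) -> is_lim_seq e 0 ->
  filterlim s eventually (@locally C_NormedModule l).
Proof.
  intros Hs He.
  apply (filterlim_locally_ball_norm (K := C_AbsRing) (U := C_NormedModule)).
  intros eps.
  destruct (proj2 (is_lim_seq_spec e 0) He eps) as [N HN].
  exists N. intros n Hn. change (Cmod (s n - l) < eps)%R.
  specialize (HN n Hn). rewrite Rminus_0_r in HN. apply Rabs_def2 in HN.
  specialize (Hs n). lra.
Qed.

Lemma is_lim_seq_geom_scal (K r : R) : (0 <= r < 1)%R ->
  is_lim_seq (fun n => K * r ^ n)%R 0.
Proof.
  intros Hr. replace (Finite 0) with (Rbar_mult K 0) by (simpl; f_equal; ring).
  apply is_lim_seq_scal_l, is_lim_seq_geom. rewrite Rabs_pos_eq; lra.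
Qed.

Lemma is_Cseries_Cexp (z : C) :
  is_Cseries (fun k => z ^ k / RtoC (INR (fact k))) (Cexp z).
Proof.
  apply filterlim_C_Cmod with
    (fun n => exp (Cmod z) * (Cmod z ^ S n / INR (fact (S n))))%R.
  - intros n. rewrite <- Cmod_opp.
    change (Cmod (- (exp_taylor z n - Cexp z))
      <= exp (Cmod z) * (Cmod z ^ S n / INR (fact (S n))))%R.
    replace (- (exp_taylor z n - Cexp z)) with (Cexp z - exp_taylor z n) by ring.
    apply exp_taylor_error.
  - replace (Finite 0) with (Rbar_mult (exp (Cmod z)) 0) by (simpl; f_equal; ring).
    apply is_lim_seq_scal_l.
    apply (is_lim_seq_incr_1 (fun n => (Cmod z ^ n / INR (fact n))%R)).
    apply is_lim_seq_Reals, cv_speed_pow_fact.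
Qed.

(** The bound is uniform in [n], as a dominating term for all truncations at once must be. *)
Lemma Cmod_exp_taylor_le (z : C) (n : nat) :
  (Cmod (exp_taylor z n) <= exp (Cmod z))%R.
Proof.
  eapply Rle_trans; [|apply (exp_ge_taylor _ n (Cmod_ge_0 z))].
  rewrite <- sum_n_Reals. unfold exp_taylor. change Cmod with (@norm C_AbsRing C_NormedModule) at 1.
  eapply Rle_trans; [apply (norm_sum_n_m (K := C_AbsRing) (V := C_NormedModule))|].
  right. apply sum_n_m_ext. intros k.
  change norm with Cmod. rewrite Cmod_div_fact, Cmod_pow. reflexivity.
Qed.

Lemma is_Cseries_geom (w : C) : (Cmod w < 1)%R ->
  is_Cseries (fun k => w ^ k) (/ (1 - w)).
Proof.
  intros Hw.
  assert (Hw1 : 1 - w <> 0).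
  { intros E. assert (w = 1) by (replace w with (1 - (1 - w)) by ring; rewrite E; ring).
    subst w. rewrite Cmod_1 in Hw. lra. }
  (* The error of the partial sums is exactly [- w ^ (n + 1) / (1 - w)]. *)
  assert (Hsum : forall n, sum_n (fun k => w ^ k) n - / (1 - w) = - (w * / (1 - w)) * w ^ n).
  { induction n as [|n IH].
    - rewrite sum_O. change (w ^ 0) with (RtoC 1). field. exact Hw1.
    - rewrite sum_Sn.
      change (plus (sum_n (fun k => w ^ k) n) (w ^ S n)) with
        (sum_n (fun k => w ^ k) n + w ^ S n).
      replace (sum_n (fun k => w ^ k) n) with
        (- (w * / (1 - w)) * w ^ n + / (1 - w)) by (rewrite <- IH; ring).
      rewrite Cpow_S. field. exact Hw1. }
  apply filterlim_C_Cmod with (fun n => Cmod (- (w * / (1 - w))) * Cmod w ^ n)%R.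
  - intros n. rewrite Hsum, Cmod_mult, Cmod_pow. apply Rle_refl.
  - apply is_lim_seq_geom_scal. split; [apply Cmod_ge_0|exact Hw].
Qed.

Lemma is_Cseries_Re (u : nat -> C) (l : C) :
  is_Cseries u l -> is_series (fun k => Re (u k)) (Re l).
Proof.
  intros H. apply filterlim_locally. intros eps.
  destruct (proj1 (filterlim_locally _ _) H eps) as [N HN].
  exists N. intros n Hn. rewrite <- Re_sum_n. exact (proj1 (HN n Hn)).
Qed.

Lemma is_Cseries_Im (u : nat -> C) (l : C) :
  is_Cseries u l -> is_series (fun k => Im (u k)) (Im l).
Proof.
  intros H. apply filterlim_locally. intros eps.
  destruct (proj1 (filterlim_locally _ _) H eps) as [N HN].
  exists N. intros n Hn. rewrite <- Im_sum_n. exact (proj2 (HN n Hn)).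
Qed.

Lemma is_Cseries_unique (u : nat -> C) (l : C) : is_Cseries u l -> CSeries u = l.
Proof.
  intros H. unfold CSeries.
  rewrite (is_series_unique _ _ (is_Cseries_Re _ _ H)).
  rewrite (is_series_unique _ _ (is_Cseries_Im _ _ H)).
  now destruct l.
Qed.

Lemma is_Cseries_CSeries (u : nat -> C) :
  @ex_series C_AbsRing C_NormedModule u -> is_Cseries u (CSeries u).
Proof. intros [l H]. now rewrite (is_Cseries_unique u l H). Qed.

Lemma is_Cseries_scal (c : C) (u : nat -> C) (l : C) :
  is_Cseries u l -> is_Cseries (fun k => c * u k) (c * l).
Proof. exact (is_series_scal (K := C_AbsRing) (V := C_NormedModule) c u l). Qed.

Lemma is_Cseries_plus (u v : nat -> C) (l m : C) :
  is_Cseries u l -> is_Cseries v m -> is_Cseries (fun k => u k + v k) (l + m).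
Proof. exact (is_series_plus (K := C_AbsRing) (V := C_NormedModule) u v l m). Qed.

Lemma is_Cseries_ext (u v : nat -> C) (l : C) :
  (forall k, u k = v k) -> is_Cseries u l -> is_Cseries v l.
Proof. exact (is_series_ext (K := C_AbsRing) (V := C_NormedModule) u v l). Qed.

(** * Moments and their generating function *)

(** For [Cmod W < 1] this is the Lerch transcendent of [W] and [z] at the exponent [- n]. *)
Definition moment (W z : C) (n : nat) : C :=
  CSeries (fun j => W ^ j * (z + RtoC (INR j)) ^ n).

(** A single term of the exponential series is at most its sum, all terms being nonnegative. *)
Lemma pow_le_fact_exp (x : R) (n : nat) :
  (0 <= x -> x ^ n <= INR (fact n) * exp x)%R.
Proof.
  intros Hx.
  assert (H : (x ^ n / INR (fact n) <= exp x)%R).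
  { eapply Rle_trans; [|apply (exp_ge_taylor x n Hx)].
    destruct n as [|n]; [apply Rle_refl|].
    rewrite tech5.
    assert (0 <= sum_f_R0 (fun k => x ^ k / INR (fact k)) n)%R; [|lra].
    apply cond_pos_sum. intros k.
    apply Rmult_le_pos; [now apply pow_le|].
    left. apply Rinv_0_lt_compat, INR_fact_lt_0. }
  apply (Rmult_le_compat_l (INR (fact n))) in H; [|apply pos_INR].
  replace (INR (fact n) * (x ^ n / INR (fact n)))%R with (x ^ n)%R in H; [exact H|].
  field. apply INR_fact_neq_0.
Qed.

Lemma Cmod_add_INR_le (z : C) (j : nat) : (Cmod (z + RtoC (INR j)) <= Cmod z + INR j)%R.
Proof.
  eapply Rle_trans; [apply Cmod_triangle|].
  rewrite Cmod_R, Rabs_pos_eq by apply pos_INR. apply Rle_refl.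
Qed.

Lemma exp_INR_mult (n : nat) (x : R) : exp (x * INR n) = (exp x ^ n)%R.
Proof.
  induction n as [|n IH].
  - simpl INR. rewrite Rmult_0_r. exact exp_0.
  - rewrite S_INR, Rmult_plus_distr_l, exp_plus, IH, Rmult_1_r. simpl. ring.
Qed.

(** This turns the exponentially weighted bounds in [j] into a geometric sequence of ratio
    [w * exp tau]. *)
Lemma exp_weight_eq (w x tau : R) (j : nat) :
  (w ^ j * exp (tau * (x + INR j)) = exp (tau * x) * (w * exp tau) ^ j)%R.
Proof.
  rewrite Rmult_plus_distr_l, exp_plus, exp_INR_mult, Rpow_mult_distr. ring.
Qed.

Lemma ex_series_geom_scal (K r : R) : (0 <= r < 1)%R ->
  ex_series (fun j => K * r ^ j)%R.
Proof.
  intros Hr. apply (ex_series_scal K (fun j => r ^ j)%R).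
  apply ex_series_geom. rewrite Rabs_pos_eq; lra.
Qed.

(** The choice [exp tau = 2 / (1 + w)] exceeds [1], while [w * exp tau = 2 * w / (1 + w)] stays
    below [1]; it also covers [w = 0]. *)
Lemma exists_exp_rate (w : R) : (0 <= w < 1)%R ->
  exists tau, (0 < tau)%R /\ (0 <= w * exp tau < 1)%R.
Proof.
  intros Hw. exists (ln (2 / (1 + w))).
  assert (H : (1 < 2 / (1 + w))%R).
  { apply (Rmult_lt_reg_r (1 + w)); [lra|].
    unfold Rdiv. rewrite Rmult_assoc, Rinv_l; lra. }
  rewrite exp_ln by lra. split.
  - rewrite <- ln_1. apply ln_increasing; lra.
  - split; [apply Rmult_le_pos; lra|].
    apply (Rmult_lt_reg_r (1 + w)); [lra|].
    replace (w * (2 / (1 + w)) * (1 + w))%R with (2 * w)%R by (field; lra). lra.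
Qed.

Lemma is_Cseries_moment (W z : C) (n : nat) : (Cmod W < 1)%R ->
  is_Cseries (fun j => W ^ j * (z + RtoC (INR j)) ^ n) (moment W z n).
Proof.
  intros HW. apply is_Cseries_CSeries.
  destruct (exists_exp_rate (Cmod W)) as [tau [Htau Hr]].
  { split; [apply Cmod_ge_0|exact HW]. }
  apply (ex_series_le (K := C_AbsRing) (V := C_CompleteNormedModule) _ (fun j =>
    (INR (fact n) / tau ^ n * exp (tau * Cmod z)) * (Cmod W * exp tau) ^ j)%R).
  2: now apply ex_series_geom_scal.
  intros j. change norm with Cmod. rewrite Cmod_mult, !Cmod_pow.
  rewrite Rmult_assoc, <- exp_weight_eq.
  assert (Hx : (0 <= tau * (Cmod z + INR j))%R).
  { generalize (Cmod_ge_0 z) (pos_INR j). intros; apply Rmult_le_pos; lra. }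
  assert (Htn : (0 < tau ^ n)%R) by now apply pow_lt.
  (* Scaling the base by [tau] before comparing the power with an exponential makes the growth rate
     exactly [tau], small enough for the geometric decay of [W ^ j] to win. *)
  apply Rle_trans with
    (Cmod W ^ j * (/ tau ^ n * (tau * (Cmod z + INR j)) ^ n))%R.
  - apply Rmult_le_compat_l; [apply pow_le, Cmod_ge_0|].
    rewrite Rpow_mult_distr, <- Rmult_assoc, Rinv_l, Rmult_1_l by lra.
    apply pow_incr. split; [apply Cmod_ge_0|apply Cmod_add_INR_le].
  - replace (INR (fact n) / tau ^ n * (Cmod W ^ j * exp (tau * (Cmod z + INR j))))%R
      with (Cmod W ^ j * (/ tau ^ n * (INR (fact n) * exp (tau * (Cmod z + INR j)))))%R
      by (field; lra).
    apply Rmult_le_compat_l; [apply pow_le, Cmod_ge_0|].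
    apply Rmult_le_compat_l; [left; now apply Rinv_0_lt_compat|].
    now apply pow_le_fact_exp.
Qed.

Lemma is_Cseries_sum_n (u : nat -> nat -> C) (l : nat -> C) (N : nat) :
  (forall n, is_Cseries (u n) (l n)) ->
  is_Cseries (fun j => sum_n (fun n => u n j) N) (sum_n l N).
Proof.
  intros H. induction N as [|N IH].
  - rewrite sum_O. apply is_Cseries_ext with (u 0%nat); [|apply H].
    intros j. now rewrite sum_O.
  - rewrite sum_Sn. apply is_Cseries_ext with (fun j => sum_n (fun n => u n j) N + u (S N) j).
    + intros j. now rewrite sum_Sn.
    + now apply is_Cseries_plus.
Qed.

Lemma is_Cseries_moment_gf (W z : C) : (Cmod W < 1)%R ->
  exists r, (0 < r)%R /\ forall t, (Cmod t < r)%R ->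
    1 - W * Cexp t <> 0 /\
    is_Cseries (fun n => moment W z n * (t ^ n / RtoC (INR (fact n))))
      (Cexp (t * z) / (1 - W * Cexp t)).
Proof.
  intros HW.
  destruct (exists_exp_rate (Cmod W)) as [tau [Htau Hr]].
  { split; [apply Cmod_ge_0|exact HW]. }
  exists tau. split; [exact Htau|]. intros t Ht.
  assert (HWt : (Cmod (W * Cexp t) < 1)%R).
  { rewrite Cmod_mult. eapply Rle_lt_trans; [|apply Hr].
    apply Rmult_le_compat_l; [apply Cmod_ge_0|].
    eapply Rle_trans; [apply Cmod_Cexp_le|]. apply exp_nondecreasing. lra. }
  split.
  { intros E. replace (W * Cexp t) with (1 - (1 - W * Cexp t)) in HWt by ring.
    rewrite E in HWt. replace (1 - 0) with (RtoC 1) in HWt by ring.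
    rewrite Cmod_1 in HWt. lra. }
  (* The limit variable is the order [N] at which each exponential is truncated. For [Cmod t < tau]
     every truncation is dominated by one geometric sequence in [j]. *)
  apply (series_dominated_convergence (K := C_AbsRing) (V := C_NormedModule)
    (fun N j => W ^ j * exp_taylor (t * (z + RtoC (INR j))) N)
    (fun j => W ^ j * Cexp (t * (z + RtoC (INR j))))
    _ _ (fun j => exp (tau * Cmod z) * (Cmod W * exp tau) ^ j)%R).
  - now apply ex_series_geom_scal.
  - intros N j. change norm with Cmod. rewrite Cmod_mult, Cmod_pow, <- exp_weight_eq.
    apply Rmult_le_compat_l; [apply pow_le, Cmod_ge_0|].
    eapply Rle_trans; [apply Cmod_exp_taylor_le|]. apply exp_nondecreasing.
    rewrite Cmod_mult. apply Rmult_le_compat; try apply Cmod_ge_0; [lra|].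
    apply Cmod_add_INR_le.
  - intros j.
    eapply filterlim_ext; [|exact (is_Cseries_scal (W ^ j) _ _ (is_Cseries_Cexp (t * (z + RtoC (INR j)))))].
    intros N. apply (sum_n_mult_l (K := C_Ring)).
  (* For fixed [N], a finite sum in [n] may be exchanged with the series in [j], giving the [N]-th
     partial sum of the moment series. *)
  - intros N.
    apply is_Cseries_ext with (fun j => sum_n (fun n =>
      t ^ n / RtoC (INR (fact n)) * (W ^ j * (z + RtoC (INR j)) ^ n)) N).
    + intros j. unfold exp_taylor.
      rewrite <- (sum_n_mult_l (K := C_Ring)). apply sum_n_ext. intros n.
      rewrite Cpow_mult_l. unfold Cdiv.
      match goal with |- @eq _ ?a ?b => change (@eq C a b) end.
      change mult with Cmult. ring.
    + apply (is_Cseries_sum_n (fun n j => t ^ n / RtoC (INR (fact n)) * (W ^ j * (z + RtoC (INR j)) ^ n))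
        (fun n => moment W z n * (t ^ n / RtoC (INR (fact n))))).
      intros n. rewrite Cmult_comm. now apply is_Cseries_scal, is_Cseries_moment.
  (* With the full exponentials the series is geometric of ratio [W * Cexp t]. *)
  - apply is_Cseries_ext with (fun j => Cexp (t * z) * (W * Cexp t) ^ j).
    + intros j. rewrite Cpow_mult_l, <- Cexp_INR_mult.
      replace (t * (z + RtoC (INR j))) with (t * z + RtoC (INR j) * t) by ring.
      rewrite Cexp_plus. ring.
    + now apply is_Cseries_scal, is_Cseries_geom.
Qed.

(** * Uniqueness of power series coefficients *)

(** If [r / 2] lay outside the disk of convergence, the terms there could not tend to [0], against
    the assumed convergence. *)
Lemma CV_radius_pos (a : nat -> R) (r : R) : (0 < r)%R ->
  (forall x, (Rabs x < r)%R -> ex_series (fun n => a n * x ^ n)%R) ->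
  Rbar_lt 0 (CV_radius a).
Proof.
  intros Hr H.
  apply Rbar_lt_le_trans with (Rabs (r / 2)).
  { simpl. rewrite Rabs_pos_eq; lra. }
  apply Rbar_not_lt_le. intros Hlt.
  apply (CV_disk_outside a (r / 2) Hlt), ex_series_lim_0, H.
  rewrite Rabs_pos_eq; lra.
Qed.

Lemma power_series_coeff_unique (a b : nat -> R) (r : R) : (0 < r)%R ->
  (forall x, (Rabs x < r)%R -> exists l,
    is_series (fun n => a n * x ^ n)%R l /\ is_series (fun n => b n * x ^ n)%R l) ->
  forall n, a n = b n.
Proof.
  intros Hr H n. apply PSeries_ext_recip.
  - apply (CV_radius_pos a r Hr). intros x Hx. destruct (H x Hx) as [l [Hl _]]. now exists l.
  - apply (CV_radius_pos b r Hr). intros x Hx. destruct (H x Hx) as [l [_ Hl]]. now exists l.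
  - exists (mkposreal r Hr). intros x Hx.
    assert (Hx' : (Rabs x < r)%R).
    { unfold ball in Hx; simpl in Hx. unfold AbsRing_ball, abs, minus, plus, opp in Hx; simpl in Hx.
      now rewrite Ropp_0, Rplus_0_r in Hx. }
    destruct (H x Hx') as [l [Ha Hb]].
    unfold PSeries. now rewrite (is_series_unique _ _ Ha), (is_series_unique _ _ Hb).
Qed.

(** Restricting to real [t] splits each series into two real power series, with coefficients the
    real and imaginary parts divided by [n!]. *)
Lemma exp_series_coeff_unique (u v : nat -> C) (r : R) : (0 < r)%R ->
  (forall t, (Cmod t < r)%R -> exists l,
    is_Cseries (fun n => u n * (t ^ n / RtoC (INR (fact n)))) l /\
    is_Cseries (fun n => v n * (t ^ n / RtoC (INR (fact n)))) l) ->
  forall n, u n = v n.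
Proof.
  intros Hr H n.
  assert (E : forall (c : C) (x : R) k,
    c * (RtoC x ^ k / RtoC (INR (fact k))) = c * RtoC (/ INR (fact k) * x ^ k)).
  { intros c x k. rewrite Cdiv_INR_fact, RtoC_mult, RtoC_pow. ring. }
  assert (cancel : forall x y, (x * / INR (fact n) = y * / INR (fact n))%R -> x = y).
  { intros x y Hxy. apply Rmult_eq_reg_r in Hxy; [exact Hxy|].
    apply Rinv_neq_0_compat, INR_fact_neq_0. }
  apply injective_projections; apply cancel.
  - apply (power_series_coeff_unique (fun k => fst (u k) * / INR (fact k))%R
      (fun k => fst (v k) * / INR (fact k))%R r Hr).
    intros x Hx. destruct (H (RtoC x)) as [l [Hu Hv]]; [now rewrite Cmod_R|].
    exists (Re l). split.
    + eapply is_series_ext; [|exact (is_Cseries_Re _ _ Hu)].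
      intros k. cbv beta. rewrite E, re_scal_r. unfold Re. now rewrite Rmult_assoc.
    + eapply is_series_ext; [|exact (is_Cseries_Re _ _ Hv)].
      intros k. cbv beta. rewrite E, re_scal_r. unfold Re. now rewrite Rmult_assoc.
  - apply (power_series_coeff_unique (fun k => snd (u k) * / INR (fact k))%R
      (fun k => snd (v k) * / INR (fact k))%R r Hr).
    intros x Hx. destruct (H (RtoC x)) as [l [Hu Hv]]; [now rewrite Cmod_R|].
    exists (Im l). split.
    + eapply is_series_ext; [|exact (is_Cseries_Im _ _ Hu)].
      intros k. cbv beta. rewrite E, im_scal_r. unfold Im. now rewrite Rmult_assoc.
    + eapply is_series_ext; [|exact (is_Cseries_Im _ _ Hv)].
      intros k. cbv beta. rewrite E, im_scal_r. unfold Im. now rewrite Rmult_assoc.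
Qed.

(** * Bernoulli polynomials as combinations of moments *)

Lemma is_hq_bernoulli_moment (logq q xi z : C) (h : nat) :
  (Cmod (xi * q ^ h) < 1)%R ->
  is_hq_bernoulli logq q xi h z (fun n =>
    - (RtoC (INR h) * logq * moment (xi * q ^ h) z n
       + RtoC (INR n) * moment (xi * q ^ h) z (n - 1))).
Proof.
  intros HW. destruct (is_Cseries_moment_gf (xi * q ^ h) z HW) as [r [Hr H]].
  exists r. split; [exact Hr|]. intros t Ht.
  destruct (H t Ht) as [Hne Hgf].
  set (W := xi * q ^ h) in *. set (L := RtoC (INR h) * logq).
  set (G := Cexp (t * z) / (1 - W * Cexp t)) in *.
  (* Multiplication by [t] shifts the coefficients, since [t * t ^ k / k! = (k + 1) * t ^ (k + 1) /
     (k + 1)!]. At [n = 0] the factor [INR n] kills the truncated index [n - 1]. *)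
  assert (Hshift : is_Cseries (fun n =>
      RtoC (INR n) * moment W z (n - 1) * (t ^ n / RtoC (INR (fact n)))) (t * G)).
  { apply (is_series_decr_1 (K := C_AbsRing) (V := C_NormedModule)).
    replace (plus _ _) with (t * G).
    - apply is_Cseries_ext with (2 := is_Cseries_scal t _ _ Hgf).
      intros k. rewrite fact_simpl, mult_INR, RtoC_mult, Cpow_S.
      replace (S k - 1)%nat with k by lia. field. split; intros E0; apply RtoC_inj in E0.
      + now apply INR_fact_neq_0 in E0.
      + now apply not_0_INR in E0.
    - simpl INR. change (t * G = t * G + - (0 * moment W z (0 - 1) * (t ^ 0 / RtoC 1))). ring. }
  (* The sign comes from the denominator [W * Cexp t - 1], opposite to that of the geometric sum. *)
  replace ((t + L) * Cexp (t * z) / (W * Cexp t - 1)) with (- 1 * (L * G + t * G)).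
  - apply is_Cseries_ext with
      (2 := is_Cseries_scal (-1) _ _ (is_Cseries_plus _ _ _ _ (is_Cseries_scal L _ _ Hgf) Hshift)).
    intros k. simpl. ring.
  - unfold G. field. split; [|exact Hne].
    intros E. apply Hne. replace (1 - W * Cexp t) with (- (W * Cexp t - 1)) by ring.
    rewrite E. ring.
Qed.

(** Since an expansion exists, the sequence chosen by [epsilon] satisfies one too; on the smaller of
    the two disks the coefficients must agree. *)
Lemma hq_bernoulli_moment (logq q xi z : C) (h n : nat) :
  (Cmod (xi * q ^ h) < 1)%R ->
  hq_bernoulli logq q xi h n z =
    - (RtoC (INR h) * logq * moment (xi * q ^ h) z n
       + RtoC (INR n) * moment (xi * q ^ h) z (n - 1)).
Proof.
  intros HW.
  pose proof (is_hq_bernoulli_moment logq q xi z h HW) as Hb.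
  pose proof (epsilon_spec (inhabits (fun _ : nat => RtoC 0))
    (is_hq_bernoulli logq q xi h z) (ex_intro _ _ Hb)) as He.
  unfold hq_bernoulli.
  destruct Hb as [r1 [Hr1 H1]], He as [r2 [Hr2 H2]].
  revert n. apply exp_series_coeff_unique with (Rmin r1 r2); [now apply Rmin_pos|].
  intros t Ht. eexists. split.
  - apply H2. eapply Rlt_le_trans; [exact Ht|apply Rmin_r].
  - apply H1. eapply Rlt_le_trans; [exact Ht|apply Rmin_l].
Qed.

(** * Sums over a residue class *)

(** By induction on [N]: the new index [a + N + 1] lies in the class of [a] exactly when [f] divides
    [N + 1], which is when [N / f] increases. *)
Lemma sum_n_arith_progression {G : AbelianMonoid} (u : nat -> G) (a f N : nat) :
  (a < f)%nat ->
  sum_n (fun k => if Nat.eqb (k mod f) a then u k else zero) (a + N)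
  = sum_n (fun j => u (a + j * f)%nat) (N / f).
Proof.
  intros Haf. induction N as [|N IH].
  - rewrite Nat.add_0_r, Nat.Div0.div_0_l, sum_O, Nat.mul_0_l, Nat.add_0_r.
    (* No index below [a] is in the class, so the sum up to [a] has only its last term. *)
    assert (Hz : forall m, (m < a)%nat ->
      sum_n (fun k => if Nat.eqb (k mod f) a then u k else zero) m = zero).
    { induction m as [|m IHm]; intros Hm.
      - rewrite sum_O, Nat.Div0.mod_0_l. destruct (Nat.eqb_spec 0 a); [lia|reflexivity].
      - rewrite sum_Sn, IHm by lia. rewrite plus_zero_l, Nat.mod_small by lia.
        destruct (Nat.eqb_spec (S m) a); [lia|reflexivity]. }
    destruct a as [|a'].
    + rewrite sum_O, Nat.mod_small by lia. now rewrite Nat.eqb_refl.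
    + rewrite sum_Sn, Hz by lia. rewrite plus_zero_l, Nat.mod_small by lia.
      now rewrite Nat.eqb_refl.
  - rewrite Nat.add_succ_r, sum_Sn, IH.
    pose proof (Nat.div_mod_eq N f) as EN.
    pose proof (Nat.mod_upper_bound N f ltac:(lia)) as BN.
    set (Q := (N / f)%nat) in *. set (s := (N mod f)%nat) in *.
    destruct (Nat.eq_dec (S s) f) as [Es|Es].
    + assert (EQ : (S N / f = S Q)%nat).
      { symmetry. apply Nat.div_unique with 0%nat; lia. }
      rewrite EQ, sum_Sn.
      replace (S (a + N)) with (a + S Q * f)%nat by lia.
      rewrite Nat.Div0.mod_add, Nat.mod_small, Nat.eqb_refl by lia. reflexivity.
    + assert (EQ : (S N / f = Q)%nat).
      { symmetry. apply Nat.div_unique with (S s); lia. }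
      rewrite EQ.
      (* Membership in the class would make [S s] a multiple of [f], although [0 < S s < f]. *)
      destruct (Nat.eqb_spec (S (a + N) mod f) a) as [E|E]; [|apply plus_zero_r].
      exfalso.
      pose proof (Nat.div_mod_eq (S (a + N)) f) as E2. rewrite E in E2.
      set (P := (S (a + N) / f)%nat) in *.
      assert (f * P = f * Q + S s)%nat by lia.
      assert (P <= Q \/ S Q <= P)%nat as [C1|C1] by lia; nia.
Qed.

Lemma sum_congr_arith_progression (u : nat -> C) (a f : nat) (l : C) :
  (0 < a < f)%nat ->
  is_Cseries (fun j => u (a + j * f)%nat) l -> sum_congr a f u = l.
Proof.
  intros Haf H. unfold sum_congr. rewrite (Nat.mod_small a f) by lia.
  apply is_Cseries_unique.
  apply is_Cseries_ext with (fun k => if Nat.eqb (k mod f) a then u k else RtoC 0).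
  { intros [|k]; [|reflexivity]. rewrite Nat.Div0.mod_0_l.
    destruct (Nat.eqb_spec 0 a); [lia|reflexivity]. }
  intros P HP. destruct (H P HP) as [N HN].
  (* Beyond this index, [(n - a) / f] is at least [N]. *)
  exists (a + N * f)%nat. intros n Hn.
  replace n with (a + (n - a))%nat by lia.
  pose proof (sum_n_arith_progression u a f (n - a) ltac:(lia)) as E.
  match goal with |- P ?x => replace x with (sum_n (fun j => u (a + j * f)%nat) ((n - a) / f))
    by (symmetry; exact E) end.
  apply HN. apply Nat.div_le_lower_bound; lia.
Qed.

(** * Partial zeta sums at nonpositive integers *)

Lemma root_of_unity_Cmod (xi : C) : root_of_unity xi -> Cmod xi = 1%R.
Proof.
  intros [m [Hm E]].
  assert (H : (Cmod xi ^ m = 1)%R) by now rewrite <- Cmod_pow, E, Cmod_1.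
  generalize (Cmod_ge_0 xi). intros H0.
  destruct (Rtotal_order (Cmod xi) 1) as [H1|[H1|H1]]; [|exact H1|].
  - assert (Cmod xi ^ m < 1)%R; [|lra]. apply pow_lt_1_compat; [lra|exact Hm].
  - assert (1 < Cmod xi ^ m)%R; [|lra]. now apply Rlt_pow_R1.
Qed.

Lemma nat_cpow_opp_INR (k m : nat) : (0 < k)%nat ->
  nat_cpow k (- RtoC (INR m)) = / RtoC (INR k) ^ m.
Proof.
  intros Hk. assert (0 < INR k)%R by now apply lt_0_INR.
  assert (E : Cexp (RtoC (ln (INR k))) = RtoC (INR k)).
  { unfold Cexp, RtoC; simpl. rewrite exp_ln, cos_0, sin_0 by assumption. f_equal; ring. }
  assert (Hne : RtoC (INR k) ^ m <> 0).
  { apply Cpow_nz. intros E0. apply RtoC_inj in E0. lra. }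
  unfold nat_cpow.
  rewrite <- (Cmult_1_r (Cexp _)), <- (Cinv_r _ Hne), Cmult_assoc.
  replace (Cexp _ * RtoC (INR k) ^ m) with (RtoC 1); [apply Cmult_1_l|].
  rewrite <- E, <- Cexp_INR_mult, <- Cexp_plus, <- Cexp_0. f_equal. ring.
Qed.

(** Along [k = a + j * f] one has [k = f * (a / f + j)], so [k ^ m] contributes [f ^ m] times the
    moment weight, and [q ^ (k * h) * xi ^ k] contributes the [j]-th power of
    [xi ^ f * (q ^ f) ^ h]. *)
Lemma sum_congr_moment (q xi : C) (h a f m : nat) :
  (0 < a < f)%nat -> (Cmod (xi ^ f * (q ^ f) ^ h) < 1)%R ->
  sum_congr a f (fun k => q ^ (k * h) * xi ^ k / nat_cpow k (- RtoC (INR m)))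
  = q ^ (h * a) * xi ^ a * RtoC (INR f) ^ m
    * moment (xi ^ f * (q ^ f) ^ h) (RtoC (INR a) / RtoC (INR f)) m.
Proof.
  intros Haf HW. apply (sum_congr_arith_progression _ _ _ _ Haf).
  apply is_Cseries_ext with (2 := is_Cseries_scal _ _ _ (is_Cseries_moment _ _ m HW)).
  intros j. cbv beta.
  assert (Hf : RtoC (INR f) <> 0).
  { intros E. apply RtoC_inj in E. apply (not_0_INR f); [lia|exact E]. }
  assert (Hk : RtoC (INR (a + j * f)) <> 0).
  { intros E. apply RtoC_inj in E. apply (not_0_INR (a + j * f)); [lia|exact E]. }
  rewrite nat_cpow_opp_INR by lia.
  replace (q ^ ((a + j * f) * h)) with (q ^ (h * a) * ((q ^ f) ^ h) ^ j)
    by (rewrite <- !Cpow_mult_r, <- Cpow_add_r; f_equal; lia).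
  replace (xi ^ (a + j * f)) with (xi ^ a * (xi ^ f) ^ j)
    by (rewrite <- Cpow_mult_r, <- Cpow_add_r; f_equal; lia).
  replace (RtoC (INR a) / RtoC (INR f) + RtoC (INR j))
    with (RtoC (INR (a + j * f)) / RtoC (INR f))
    by (rewrite plus_INR, mult_INR, RtoC_plus, RtoC_mult; field; exact Hf).
  unfold Cdiv. rewrite !Cpow_mult_l, Cpow_inv by exact Hf.
  field. split; apply Cpow_nz; assumption.
Qed.

Theorem corollary1 (q logq xi : C) (h a f n : nat)
  (hq : (0 < Cmod q < 1)%R) (hlog : Cexp logq = q)
  (hh : (0 < h)%nat) (hxi : root_of_unity xi)
  (haf : (0 < a < f)%nat) (hn : (0 < n)%nat) :
  hq_partial_zeta logq q xi h (1 - RtoC (INR n)) a f =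
  - (q ^ (h * a) * xi ^ a * RtoC (INR f) ^ (n - 1)
     * hq_bernoulli (RtoC (INR f) * logq) (q ^ f) (xi ^ f) h n
         (RtoC (INR a) / RtoC (INR f)))
  / RtoC (INR n).
Proof.
  (* Here [Cmod xi = 1], and the exponent [f * h] of [Cmod q < 1] is positive. *)
  assert (HW : (Cmod (xi ^ f * (q ^ f) ^ h) < 1)%R).
  { rewrite Cmod_mult, !Cmod_pow, (root_of_unity_Cmod xi hxi), pow1, Rmult_1_l, <- pow_mult.
    apply pow_lt_1_compat; [lra|nia]. }
  rewrite hq_bernoulli_moment by exact HW.
  destruct n as [|n]; [lia|].
  unfold hq_partial_zeta.
  (* From here [S n] is the original index: the second sum gives the moment of order [S n], the
     first that of order [n]. The extra factor [f] in the second matches the logarithm [f * logq] of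
     [q ^ f]. *)
  replace (1 - RtoC (INR (S n)) - 1) with (- RtoC (INR (S n))) by ring.
  replace (1 - RtoC (INR (S n))) with (- RtoC (INR n))
    by (rewrite S_INR, RtoC_plus; ring).
  rewrite !sum_congr_moment by assumption.
  replace (S n - 1)%nat with n by lia. rewrite Cpow_S.
  field. intros E. apply RtoC_inj in E. now apply (not_0_INR (S n)) in E.
Qed.
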